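(* For $n\ge2$ and $1\le i<j\le n$ let $r_{n,i,j}=\sum_\pi y^{\mu(\pi)}$, the sum over all $\pi\in\mathcal{D}_{3\text{-}21}(n)$ whose last cycle (in standard cycle form) starts with $i$ and ends with $j$, and let $s_{n,i,j}$ be the same sum restricted to those $\pi$ whose last cycle has length at least three. Let $R(x,u,v)=\sum_{n\ge2}\sum_{i=1}^{n-1}\sum_{j=i+1}^n r_{n,i,j}u^{n-1-i}v^{n-j}x^n$ and define $S(x,u,v)$ likewise with $s_{n,i,j}$. For $m\ge1$ let $R_m(x,u,v)=[y^m]R(x,u,v)$, $S_m(x,u,v)=[y^m]S(x,u,v)$, with $R_0=S_0=0$, and let $$R'_m(x,u)=x^2u\,\delta_{m,1}-(1-xu)S_{m-1}(x,1,u)+S_{m-1}\Big(x,1,\frac{u}{1-xu}\Big).$$ Then for every $m\ge1$, \begin{align*} R_m(x,u,v)&=\frac{x^2(1-v)(1+xuv)}{1-v+xuv}\,\delta_{m,1}+\frac{x(1+xuv)}{1-v+xuv}\big(S_{m-1}(x,1,u)-vS_{m-1}(x,1,uv)\big)\\ &\quad+\frac{x(1+xuv)}{1-v+xuv}\sum_{j\ge0}\frac{(xu)^j(1-jxu)}{\prod_{i=1}^{j+1}(1-ixu)}R'_m\Big(x,\frac{u}{1-jxu}\Big)\\ &\quad-\frac{x^2uv^2}{1-v+xuv}\sum_{j\ge0}\frac{(xuv)^j(1-jxuv)}{\prod_{i=1}^{j+1}(1-ixuv)}R'_m\Big(x,\frac{uv}{1-jxuv}\Big). \end{align*} Furthermore,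 $$S_m(x,u,v)=R_m(x,u,v)-x^2\delta_{m,1}-\frac{x}{1-v}\big(S_{m-1}(x,1,u)-vS_{m-1}(x,1,uv)\big).$$
   Context: Every permutation $\pi$ of $[n]=\{1,\dots,n\}$ is written in standard cycle form: each cycle is written starting with its smallest element, and the cycles are ordered from left to right by increasing first elements. The flattened form $\mathrm{flat}(\pi)$ is the word (in one-line notation) obtained by erasing the parentheses of the standard cycle form. A derangement is a permutation with no fixed points; $\mathcal{D}(n)$ is the set of derangements of $[n]$, and $\mu(\pi)$ denotes the number of cycles of $\pi$. A word $w=w_1\cdots w_n$ of distinct integers contains the vincular pattern $3\text{-}21$ if there are indices $i<j$ with $j+1\le n$ and $w_{j+1}<w_j<w_i$, and avoids it otherwise. $\mathcal{D}_{3\text{-}21}(n)$ is the set of $\pi\in\mathcal{D}(n)$ such that $\mathrm{flat}(\pi)$ avoids $3\text{-}21$. $\delta$ is the Kronecker delta; generating functions are formal power series in $x$; $[y^m]$ denotes coefficient extraction. *)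

(* Defs.v *)
From HB Require Import structures.
From mathcomp Require Import all_boot all_order all_algebra all_fingroup.
From mathcomp Require Import boolp.

Set Implicit Arguments.
Unset Strict Implicit.
Unset Printing Implicit Defensive.

Import GRing.Theory.
Local Open Scope ring_scope.

(* Formal power series in one variable x; [f n] is the coefficient of x^n. *)
Record fps (K : Type) := Fps { fpscoef :> nat -> K }.

Lemma fpsP (K : Type) (f g : fps K) : (forall n, f n = g n) <-> f = g.
Proof.
split=> [|-> //]; case: f => f; case: g => g /= fg; congr Fps.
exact/funext.
Qed.

HB.instance Definition _ (K : Type) := gen_eqMixin (fps K).
HB.instance Definition _ (K : Type) := gen_choiceMixin (fps K).

Section FpsRing.
Variable K : comUnitRingType.
Implicit Types f g h : fps K.

Definition fpsC (a : K) : fps K := Fps (fun n => if n is 0%N then a else 0).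
Definition fpsX : fps K := Fps (fun n => (n == 1%N)%:R).

Definition fps_add f g : fps K := Fps (fun n => f n + g n).
Definition fps_opp f : fps K := Fps (fun n => - f n).
Definition fps_mul f g : fps K :=
  Fps (fun n => \sum_(i < n.+1) f i * g (n - i)%N).

Fact fps_addA : associative fps_add.
Proof. by move=> f g h; apply/fpsP => n /=; rewrite addrA. Qed.

Fact fps_addC : commutative fps_add.
Proof. by move=> f g; apply/fpsP => n /=; rewrite addrC. Qed.

Fact fps_add0 : left_id (fpsC 0) fps_add.
Proof. by move=> f; apply/fpsP => -[|n] /=; rewrite add0r. Qed.

Fact fps_addN : left_inverse (fpsC 0) fps_opp fps_add.
Proof. by move=> f; apply/fpsP => -[|n] /=; rewrite addNr. Qed.

HB.instance Definition _ := GRing.isZmodule.Build (fps K)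
  fps_addA fps_addC fps_add0 fps_addN.

Let T m f : {poly K} := \poly_(i < m.+1) f i.

Let coefT m f i : (i <= m)%N -> (T m f)`_i = f i.
Proof. by move=> le_im; rewrite coef_poly ltnS le_im. Qed.

Let coef_mulT m f g n :
  (n <= m)%N -> fps_mul f g n = (T m f * T m g)`_n.
Proof.
move=> le_nm; rewrite coefM /=; apply: eq_bigr => i _.
by rewrite !coefT // (leq_trans _ le_nm) ?leq_subr // -ltnS.
Qed.

Fact fps_mulC : commutative fps_mul.
Proof. by move=> f g; apply/fpsP => n; rewrite !(@coef_mulT n) // mulrC. Qed.

Fact fps_mulA : associative fps_mul.
Proof.
move=> f g h; apply/fpsP => n.
transitivity (T n f * (T n g * T n h))`_n.
  rewrite coefM; apply: eq_bigr => i _.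
  by rewrite (@coef_mulT n) ?leq_subr // coefT // -ltnS.
rewrite mulrA coefM; apply: eq_bigr => i _.
by rewrite (@coef_mulT n) -1?ltnS // coefT // leq_subr.
Qed.

Fact fps_mul1 : left_id (fpsC 1) fps_mul.
Proof.
move=> f; apply/fpsP => n /=; rewrite big_ord_recl /= mul1r subn0 big1 ?addr0 //.
by move=> i _; rewrite mul0r.
Qed.

Fact fps_mulD : left_distributive fps_mul fps_add.
Proof.
move=> f g h; apply/fpsP => n /=; rewrite -big_split /=.
by apply: eq_bigr => i _; rewrite mulrDl.
Qed.

Fact fps_one_neq0 : fpsC 1 != 0.
Proof.
by apply/eqP => /fpsP/(_ 0%N)/= /eqP; rewrite oner_eq0.
Qed.

HB.instance Definition _ := GRing.Zmodule_isComNzRing.Build (fps K)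
  fps_mulA fps_mulC fps_mul1 fps_mulD fps_one_neq0.

Lemma coef_fps0 n : (0 : fps K) n = 0.
Proof. by case: n. Qed.
Lemma coef_fps1 n : (1 : fps K) n = (n == 0%N)%:R.
Proof. by case: n. Qed.
Lemma coef_fpsD f g n : (f + g) n = f n + g n.
Proof. by []. Qed.
Lemma coef_fpsN f n : (- f) n = - f n.
Proof. by []. Qed.
Lemma coef_fpsM f g n :
  (f * g) n = \sum_(i < n.+1) f i * g (n - i)%N.
Proof. by []. Qed.
Lemma coef_fps_sum (I : Type) (r : seq I) (P : pred I) (F : I -> fps K) n :
  (\sum_(i <- r | P i) F i) n = \sum_(i <- r | P i) F i n.
Proof.
elim/big_rec2: _ => [|i y z _ <-]; [exact: coef_fps0 | exact: coef_fpsD].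
Qed.

(* [fps_inv_seq f n] lists the coefficients of x^0, ..., x^n in 1/f. *)
Fixpoint fps_inv_seq f n : seq K :=
  if n is n'.+1 then
    let s := fps_inv_seq f n' in
    rcons s (- ((f 0%N)^-1 * \sum_(i < n) f (n - i)%N * s`_i))
  else [:: (f 0%N)^-1].

Definition fps_unit : {pred fps K} := [pred f : fps K | f 0%N \is a GRing.unit].
Definition fps_inv f : fps K :=
  if f \in fps_unit then Fps (fun n => (fps_inv_seq f n)`_n) else f.

Let size_inv_seq f n : size (fps_inv_seq f n) = n.+1.
Proof. by elim: n => //= n IHn; rewrite size_rcons IHn. Qed.

Let nth_inv_seq f n i :
  (i <= n)%N -> (fps_inv_seq f n)`_i = (fps_inv_seq f i)`_i.
Proof.
elim: n => [|n IHn]; first by rewrite leqn0 => /eqP->.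
rewrite leq_eqVlt => /predU1P[-> //|]; rewrite ltnS => le_in.
by rewrite [fps_inv_seq f n.+1]/= nth_rcons size_inv_seq ltnS le_in IHn.
Qed.

Fact fps_mulV : {in fps_unit, left_inverse 1 fps_inv *%R}.
Proof.
move=> f Uf; rewrite mulrC; apply/fpsP => n; rewrite coef_fps1 coef_fpsM.
rewrite /fps_inv Uf; case: n => [|n]; rewrite inE in Uf.
  by rewrite big_ord_recl big_ord0 addr0 /= divrr.
rewrite big_ord_recl subn0 /= nth_rcons size_inv_seq ltnn eqxx.
rewrite mulrN mulrA divrr // mul1r addrC; apply/eqP.
rewrite subr_eq0; apply/eqP; rewrite [LHS](reindex_inj rev_ord_inj) /=.
apply: eq_bigr => i _; have le_in: (i <= n)%N by rewrite -ltnS.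
rewrite /bump /= add1n !subSS subKn // [in RHS]nth_inv_seq //.
by rewrite subSn.
Qed.

Fact fps_unitPl f g : g * f = 1 -> fps_unit f.
Proof.
move=> /fpsP/(_ 0%N); rewrite coef_fpsM big_ord_recl big_ord0 addr0 /= => fg.
by rewrite /fps_unit /= unfold_in; apply/unitrPr; exists (g 0%N); rewrite mulrC.
Qed.

Fact fps_inv_out : {in [predC fps_unit], fps_inv =1 id}.
Proof. by move=> f; rewrite /fps_inv inE /= => /negPf->. Qed.

HB.instance Definition _ := GRing.ComNzRing_hasMulInverse.Build (fps K)
  fps_mulV fps_unitPl fps_inv_out.

(* The sum of an infinite family of series in which x^j divides F j; the next *)
(* lemma shows that it is then the x-adic limit of the partial sums.          *)
Definition fps_sum (F : nat -> fps K) : fps K :=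
  Fps (fun n => \sum_(j < n.+1) F j n).

Lemma fps_sumP (F : nat -> fps K) :
    (forall j n, (n < j)%N -> F j n = 0) ->
  forall n J, (n < J)%N -> (\sum_(j < J) F j) n = fps_sum F n.
Proof.
move=> F0 n J lt_nJ; rewrite coef_fps_sum /=.
rewrite -!(big_mkord xpredT (fun j => F j n)).
rewrite (big_cat_nat (leq0n _) lt_nJ) /= [X in _ + X]big_nat_cond.
by rewrite [X in _ + X]big1 ?addr0 // => j /andP[/andP[lt_nj _] _]; exact: F0.
Qed.

End FpsRing.

Arguments fpsX {K}.

Notation "\fsum_ j F" := (fps_sum (fun j => F))
  (at level 41, j at level 0, F at level 41,
   format "'[' \fsum_ j '/  '  F ']'") : ring_scope.

Section Combinatorics.
Variable n : nat.
Implicit Type p : {perm 'I_n}.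

(* [k : 'I_n] stands for the letter k + 1 of [n]. As [enum 'I_n] is           *)
(* increasing, the cycles come out ordered by their smallest elements.        *)
Definition cycle_form p : seq (seq nat) :=
  [seq [seq (val l).+1 | l <- fingraph.orbit p k] |
     k <- enum 'I_n & [forall l in fingraph.orbit p k, k <= l]%N].

Definition flat p : seq nat := flatten (cycle_form p).

Definition derangement p : bool := [forall k, p k != k].

Definition mu p : nat := #|porbits p|.

Definition last_cycle p : seq nat := last [::] (cycle_form p).

Definition contains_3_21 (w : seq nat) : bool :=
  [exists i : 'I_(size w), exists j : 'I_(size w),
     [&& (i < j)%N, (j.+1 < size w)%N,
         (nth 0%N w j.+1 < nth 0%N w j)%N & (nth 0%N w j < nth 0%N w i)%N]].

Definition D_3_21 : {set {perm 'I_n}} :=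
  [set p | derangement p && ~~ contains_3_21 (flat p)].

Definition last_cycle_from_to (i j : nat) p : bool :=
  (head 0%N (last_cycle p) == i) && (last 0%N (last_cycle p) == j).

End Combinatorics.

(* Polynomials in y, i.e. 'X is y. *)
Definition r_poly (K : nzRingType) (n i j : nat) : {poly K} :=
  \sum_(p in D_3_21 n | last_cycle_from_to i j p) 'X^(mu p).

Definition s_poly (K : nzRingType) (n i j : nat) : {poly K} :=
  \sum_(p in D_3_21 n | last_cycle_from_to i j p &&
                        (3 <= size (last_cycle p))%N) 'X^(mu p).

(* \sum_(n >= 2) \sum_(1 <= i < j <= n) c n i j a^(n-1-i) b^(n-j) x^n, where  *)
(* a and b may themselves be series in x; the terms n = 0, 1 are empty sums.  *)
Definition gf (L : comUnitRingType) (c : nat -> nat -> nat -> L)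
    (a b : fps L) : fps L :=
  \fsum_n (\sum_(1 <= i < n) \sum_(i.+1 <= j < n.+1)
     fpsC (c n i j) * a ^+ (n - 1 - i)%N * b ^+ (n - j)%N * fpsX ^+ n).

Section GeneratingFunctions.
Variable K : fieldType.

Definition to_y (f : fps K) : fps {poly K} := Fps (fun n => (f n)%:P).

Definition coefy (m : nat) (f : fps {poly K}) : fps K :=
  Fps (fun n => (f n)`_m).

(* R(x,a,b) and S(x,a,b) as series in x with coefficients in K[y]. *)
Definition R_gf (a b : fps K) : fps {poly K} := gf (r_poly K) (to_y a) (to_y b).
Definition S_gf (a b : fps K) : fps {poly K} := gf (s_poly K) (to_y a) (to_y b).

Definition Rm (m : nat) (a b : fps K) : fps K :=
  if m == 0%N then 0 else coefy m (R_gf a b).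
Definition Sm (m : nat) (a b : fps K) : fps K :=
  if m == 0%N then 0 else coefy m (S_gf a b).

Definition delta (m l : nat) : fps K := (m == l)%:R.

(* R'_m(x,w); only used for m >= 1. *)
Definition Rm' (m : nat) (w : fps K) : fps K :=
  let x := fpsX in
  x ^+ 2 * w * delta m 1 - (1 - x * w) * Sm (m - 1) 1 w
  + Sm (m - 1) 1 (w / (1 - x * w)).

End GeneratingFunctions.

(* The coefficient field Q(u,v). In it 1 - v is invertible, so that           *)
(* 1 - v + xuv is an invertible power series in x.                            *)
Definition Quv : fieldType := {fraction {poly {poly rat}}}.
Definition uvar : fps Quv := fpsC (tofrac ('X%:P : {poly {poly rat}}) : Quv).
Definition vvar : fps Quv := fpsC (tofrac ('X : {poly {poly rat}}) : Quv).

(* Main.v *)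
(* Deleting the last letter j of the flattened word, and lowering the letters *)
(* above j, makes the permutations recursive. Avoiding 3-21 means that every  *)
(* descent starts at a left-to-right maximum; hence, writing r and s for the  *)
(* coefficients of y^m and s' for those of y^(m-1), one gets, when the last   *)
(* cycle has length at least three,                                           *)
(*   s_(n+1,i,j) = \sum_(i<k<j) r_(n,i,k) + [j <= n] r_(n,i,n),               *)
(* while a last cycle (i j) can be glued to the previous one, so that         *)
(*   r_(n+1,i,j) - s_(n+1,i,j) = \sum_(k<i) s'_(n,k,i).                       *)
(* For arbitrary power series a and b in x this reads                         *)
(*   (1-b) S(a,b) = x a (R(a,1) - b R(a,b)) + x a b (R(a,0) - b R(ab,0)),     *)
(*   (1-b) (R(a,b) - S(a,b)) = (1-b) x^2 [m=1] + x (S'(1,a) - b S'(1,ab)).    *)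
(* The kernel 1 - b + xab vanishes at b = 1/(1-xa), which gives               *)
(*   a R(a,1) = b R'(a) + x a b (ab R(ab,1));                                 *)
(* iterating it, with a/(1-jxa) as j-th iterate of a, yields the two sums.    *)

Require Import Defs.
From HB Require Import structures.
From mathcomp Require Import all_boot all_order all_algebra all_fingroup.
From mathcomp Require Import zify ring.

Set Implicit Arguments.
Unset Strict Implicit.
Unset Printing Implicit Defensive.

(** * Words avoiding 3-21 *)

(** Everything is counted on cycle forms. A form of size [n.+1] whose last cycle has length at least
    three arises from exactly one form of size [n] by raising the letters from [j] on and appending
    [j] to the last cycle. The only new consecutive pair is the one into [j]. If it is a descent, it
    is harmless exactly when the letter before [j] is the largest, so the previous last letter, as a
    letter of the shorter form, is either below [j] or equal to [n] ([good_rcons_bump]); this gives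
    [ns_rec]. A final 2-cycle (i j) can be glued to the preceding cycle without changing the word
    ([good_split]). Deleting [j] then leaves one cycle fewer and a last cycle of length at least
    three ending in [i], which gives [nr_rec] and explains the index m-1.

    Summing geometric series over [j] turns the recurrences into [Sm_functional] and
    [Rm_functional], valid for arbitrary series a and b. Adding them eliminates S; setting b = 0
    expresses R(a,0) through R(a,1). So [kernel_equation] leaves R(a,1) and R(ab,1) as the only
    unknowns. At b = 1/(1-xa) the kernel vanishes, and [Rm_at1_rec] relates R(a,1) to R(a/(1-xa),1)
    with a factor x in front of the latter. Its iteration therefore converges x-adically to the sums
    of the theorem ([Rm_at1_iter], [Rm_at1_sum]), used for a = u and a = uv. *)

Lemma contains_3_21P (w : seq nat) :
  reflect (exists i j, [/\ i < j, j.+1 < size w, nth 0 w j.+1 < nth 0 w j &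
                          nth 0 w j < nth 0 w i])
          (contains_3_21 w).
Proof.
apply: (iffP existsP) => [[i /existsP[j /and4P[]]]|[i [j [ij jw d1 d2]]]].
  by move=> *; exists i, j.
have jw' : j < size w by lia.
have iw : i < size w by lia.
by exists (Ordinal iw); apply/existsP; exists (Ordinal jw'); apply/and4P.
Qed.

(** The only consecutive pair that [j] adds is ([a], [j]), so a new occurrence uses it as its 21 and
    takes its 3 from [w]. *)
Lemma contains_3_21_rcons2 w a j :
  contains_3_21 (rcons (rcons w a) j) =
  contains_3_21 (rcons w a) || (j < a) && has (ltn a) w.
Proof.
have nthl k : k <= size w ->
    nth 0 (rcons (rcons w a) j) k = nth 0 (rcons w a) k.
  by move=> kw; rewrite nth_rcons size_rcons ltnS kw.
have nth_a : nth 0 (rcons w a) (size w) = a by rewrite nth_rcons ltnn eqxx.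
have nth_j : nth 0 (rcons (rcons w a) j) (size w).+1 = j.
  by rewrite nth_rcons size_rcons ltnn eqxx.
apply/contains_3_21P/orP => [[i [k [ik]]]|[/contains_3_21P[i [k [ik]]]|]].
- rewrite !size_rcons !ltnS => kw d1 d2.
  rewrite leq_eqVlt in kw; case/predU1P: kw => [kw|kw].
    have iw : i < size w by rewrite -kw.
    right; rewrite kw nth_j (nthl (size w)) // nth_a in d1 d2; rewrite d1 /=.
    apply/hasP; exists (nth 0 w i); first exact: mem_nth.
    by rewrite nthl ?(ltnW iw) // nth_rcons iw in d2.
  left; apply/contains_3_21P; exists i, k; rewrite size_rcons ltnS.
  by rewrite !nthl in d1 d2; try lia; split.
- rewrite size_rcons ltnS => kw d1 d2; exists i, k; rewrite !size_rcons.
  by rewrite !nthl; try lia; split=> //; lia.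
- case/andP=> ja /hasP[b /(nthP 0)[i iw <-]] /= ab.
  exists i, (size w); rewrite !size_rcons nth_j !nthl ?(ltnW iw) //.
  by rewrite nth_a nth_rcons iw.
Qed.

Lemma contains_3_21_map (f : nat -> nat) w : {mono f : a b / a < b} ->
  contains_3_21 (map f w) = contains_3_21 w.
Proof.
move=> fM; apply/contains_3_21P/contains_3_21P => -[i [j [ij jw]]].
  rewrite size_map in jw; rewrite !(nth_map 0) ?fM; try lia.
  by move=> *; exists i, j.
move=> d1 d2; exists i, j; rewrite size_map !(nth_map 0) ?fM //; lia.
Qed.

Lemma ltn_bump j : {mono bump j : a b / a < b}.
Proof. by move=> a b; rewrite !ltnNge leq_bump2. Qed.

(** * Standard forms and the effect of a new last letter *)

(** Cycle forms of derangements described without a permutation; [1 < size c] excludes fixed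
    points. *)
Definition std_form n (cs : seq (seq nat)) : bool :=
  [&& all (fun c => (1 < size c) && all (leq (head 0 c)) c) cs,
      sorted ltn (map (head 0) cs) & perm_eq (flatten cs) (iota 1 n)].

Lemma std_form_uniq n cs : std_form n cs -> uniq (flatten cs).
Proof. by case/and3P=> _ _ /perm_uniq ->; exact: iota_uniq. Qed.

Lemma std_form_mem n cs a : std_form n cs -> (a \in flatten cs) = (0 < a <= n).
Proof. by case/and3P=> _ _ /perm_mem ->; rewrite mem_iota add1n ltnS. Qed.

Lemma perm_iota_bump n j : 0 < j <= n.+1 ->
  perm_eq (j :: map (bump j) (iota 1 n)) (iota 1 n.+1).
Proof.
move=> /andP[j0 jn]; apply: uniq_perm; [|exact: iota_uniq|].
  rewrite cons_uniq map_inj_uniq ?iota_uniq ?andbT; last exact: (can_inj (bumpK j)).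
  by apply/mapP => -[k _]; rewrite /bump; lia.
move=> a; rewrite inE mem_iota; apply/predU1P/idP => [[->|/mapP[k]]|]; first lia.
  by rewrite mem_iota /bump => ? ->; lia.
move=> an; have [->|aj] := eqVneq a j; [by left | right].
apply/mapP; exists (unbump j a); rewrite ?unbumpK ?inE //.
by rewrite mem_iota /unbump; lia.
Qed.

Lemma perm_rcons_bump n j w : 0 < j <= n.+1 ->
  perm_eq (rcons (map (bump j) w) j) (iota 1 n.+1) = perm_eq w (iota 1 n).
Proof.
move=> jn; rewrite -(permPr (perm_iota_bump jn)) perm_rcons perm_cons.
apply/idP/idP; last exact: perm_map.
exact: (perm_map_inj (can_inj (bumpK j))).
Qed.

Lemma head_map_bump j c : 0 < j -> head 0 (map (bump j) c) = bump j (head 0 c).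
Proof. by case: c => //=; rewrite /bump; lia. Qed.

Lemma head_rcons_size (T : Type) (x0 : T) c x :
  0 < size c -> head x0 (rcons c x) = head x0 c.
Proof. by case: c. Qed.

(** [bump j] is strictly increasing and skips the value [j], so all comparisons survive and exactly
    the letter [j] is missing; [head 0 c < j] keeps the head of the last cycle minimal. *)
Lemma std_form_rcons_bump n j cs c :
    1 < size c -> head 0 c < j <= n.+1 ->
  std_form n.+1 (rcons (map (map (bump j)) cs) (rcons (map (bump j) c) j))
  = std_form n (rcons cs c).
Proof.
move=> c1 /andP[cj jn]; rewrite /std_form; have j0 : 0 < j by lia.
congr [&& _, _ & _].
- rewrite !all_rcons all_map /= size_rcons size_map ltnS c1 (ltnW c1).
  rewrite head_rcons_size ?size_map ?(ltnW c1) // head_map_bump //= all_map.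
  have -> : bump j (head 0 c) <= j by rewrite /bump; lia.
  congr (_ && _); first by apply: eq_all => a /=; rewrite leq_bump2.
  apply: eq_all => d /=; rewrite size_map head_map_bump // all_map.
  by congr (_ && _); apply: eq_all => a /=; rewrite leq_bump2.
- rewrite !map_rcons head_rcons_size ?size_map ?(ltnW c1) // head_map_bump //.
  rewrite -[RHS](mono_sorted (@ltn_bump j)) map_rcons -!map_comp.
  by congr (sorted _ (rcons _ _)); apply: eq_map => d /=; rewrite head_map_bump.
- rewrite !flatten_rcons -map_flatten -rcons_cat -map_cat perm_rcons_bump //.
  lia.
Qed.

Lemma has_ltn_std_form n w a : perm_eq (rcons w a) (iota 1 n) ->
  has (ltn a) w = (a != n).
Proof.
move=> wn.
have mw b : (b \in rcons w a) = (0 < b <= n).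
  by rewrite (perm_mem wn) mem_iota add1n ltnS.
apply/hasP/idP => [[b bw /= ab]|an].
  by have := mw b; rewrite mem_rcons inE bw orbT => /esym; lia.
have aw := mw a; rewrite mem_rcons mem_head in aw.
exists n => /=; last by move/esym: aw; lia.
have := mw n; rewrite mem_rcons inE eq_sym (negPf an) /= => ->.
by move/esym: aw; lia.
Qed.

Definition good n cs := std_form n cs && ~~ contains_3_21 (flatten cs).

Lemma good_rcons_bump n j cs c :
    1 < size c -> head 0 c < j <= n.+1 ->
  good n.+1 (rcons (map (map (bump j)) cs) (rcons (map (bump j) c) j))
  = good n (rcons cs c) && ((last 0 c < j) || (last 0 c == n)).
Proof.
move=> c1 cj; rewrite /good std_form_rcons_bump // -andbA.
case: (boolP (std_form n _)) => //= sf.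
case/lastP: c c1 cj sf => // c a _ _ sf; rewrite last_rcons.
rewrite !flatten_rcons -map_flatten map_rcons -rcons_cat -rcons_cat.
rewrite -map_cat contains_3_21_rcons2 -map_rcons.
rewrite contains_3_21_map; last exact: ltn_bump.
rewrite negb_or; rewrite rcons_cat; congr (_ && _).
(* The letters are exactly 1, ..., n, so some other letter exceeds [a] unless [a] is [n]. *)
have -> : has (ltn (bump j a)) [seq bump j i | i <- flatten cs ++ c] = (a != n).
  rewrite has_map; apply/esym; rewrite -(@has_ltn_std_form n (flatten cs ++ c)).
    by apply: eq_has => b /=; rewrite ltn_bump.
  by move: sf => /and3P[_ _]; rewrite flatten_rcons -rcons_cat.
by rewrite /bump; lia.
Qed.

Lemma bump_unbump_map j c : j \notin c -> map (bump j) (map (unbump j) c) = c.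
Proof.
move=> jc; rewrite -map_comp map_id_in // => a ac /=; rewrite unbumpK // inE.
by apply: contraNneq jc => <-.
Qed.

(** The letter [j] occurs nowhere else, so every other letter lies in the range of [bump j]. *)
Lemma good_rcons_bumpE n j cs c : good n (rcons cs (rcons c j)) ->
  exists cs' c', cs = map (map (bump j)) cs' /\ c = map (bump j) c'.
Proof.
case/andP=> /std_form_uniq; rewrite flatten_rcons -rcons_cat rcons_uniq.
rewrite mem_cat negb_or => /andP[/andP[jcs jc] _] _.
exists (map (map (unbump j)) cs), (map (unbump j) c); rewrite bump_unbump_map //.
split=> //; rewrite -map_comp map_id_in // => d dcs /=; apply: bump_unbump_map.
by apply: contraNN jcs => jd; apply/flattenP; exists d.
Qed.

(* Both forms have the same flattened word. *)
Lemma good_split n cs c i j : 1 < size c -> i < j ->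
  good n (rcons (rcons cs c) [:: i; j]) =
  good n (rcons cs (rcons (rcons c i) j)).
Proof.
move=> c1 ij; rewrite /good /std_form.
have -> : flatten (rcons (rcons cs c) [:: i; j])
    = flatten (rcons cs (rcons (rcons c i) j)).
  by rewrite !flatten_rcons -catA -!cats1 -catA.
case: (boolP (perm_eq _ _)) => [pe|]; last by rewrite !andbF.
congr (_ && _); rewrite !andbT !all_rcons !map_rcons /=.
rewrite !head_rcons_size ?size_rcons ?(ltnW c1) // c1 leqnn (ltnW ij) /=.
have ci : head 0 c != i.
  move/perm_uniq: pe; rewrite iota_uniq flatten_rcons -!rcons_cat.
  rewrite !rcons_uniq => /and3P[_ + _]; apply: contraNneq => <-.
  by rewrite mem_cat -nth0 mem_nth ?orbT // ltnW.
have -> : sorted ltn (rcons (rcons (map (head 0) cs) (head 0 c)) i) =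
    sorted ltn (rcons (map (head 0) cs) (head 0 c)) && (head 0 c < i).
  case: (map (head 0) cs) => [|h hs] /=; first by rewrite andbT.
  by rewrite rcons_path last_rcons.
lia.
Qed.

(** * Permutations and standard cycle forms *)

Lemma flatten_block_inj (T : eqType) (ss : seq (seq T)) c d x :
    uniq (flatten ss) -> c \in ss -> d \in ss -> x \in c -> x \in d -> c = d.
Proof.
elim: ss => //= e ss IH; rewrite cat_uniq => /and3P[_ /hasPn dis Uss].
have notin b : b \in ss -> x \in b -> x \notin e.
  by move=> bss xb; apply: dis; apply/flattenP; exists b.
rewrite !inE => /predU1P[->|css] /predU1P[->|dss] // xc xd.
- by have := notin d dss xd; rewrite xc.
- by have := notin c css xc; rewrite xd.
- exact: IH.
Qed.

Lemma uniq_flatten_map (S T : eqType) (t : S -> seq T) s :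
    uniq s -> {in s, forall k, uniq (t k)} ->
    {in s &, forall k l x, x \in t k -> x \in t l -> k = l} ->
  uniq (flatten (map t s)).
Proof.
elim: s => //= k s IH /andP[ks Us] Ut inj; rewrite cat_uniq Ut ?mem_head //=.
rewrite IH // ?andbT; first last.
- by move=> a b ain bin; apply: inj; rewrite inE ?ain ?bin orbT.
- by move=> a ain; apply: Ut; rewrite inE ain orbT.
apply/hasPn => x /flattenP[_ /mapP[l ls ->] xl]; apply: contra ks => xk.
by rewrite (inj k l _ _ x) // ?mem_head // inE ls orbT.
Qed.

Section CycleForm.
Variable n : nat.
Implicit Type p : {perm 'I_n}.

Definition cycle_min p (k : 'I_n) := [forall l in fingraph.orbit p k, k <= l].

Definition ord_cycle_form p : seq (seq 'I_n) :=
  [seq fingraph.orbit p k | k <- enum 'I_n & cycle_min p k].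

Lemma cycle_formE p :
  cycle_form p = map (map (fun l : 'I_n => l.+1)) (ord_cycle_form p).
Proof. by rewrite /cycle_form /ord_cycle_form -map_comp. Qed.

Lemma cycle_min_inj p k l x : cycle_min p k -> cycle_min p l ->
  x \in fingraph.orbit p k -> x \in fingraph.orbit p l -> k = l.
Proof.
move=> /forall_inP kmin /forall_inP lmin; rewrite -!fconnect_orbit => kx lx.
have symp := fconnect_sym (@perm_inj _ p).
have kl : fconnect p k l by rewrite (connect_trans kx) // symp.
apply/val_inj/eqP; rewrite eqn_leq; apply/andP; split.
  by apply: kmin; rewrite -fconnect_orbit.
by apply: lmin; rewrite -fconnect_orbit symp.
Qed.

Lemma cycle_min_ex p x : exists2 k, cycle_min p k & x \in fingraph.orbit p k.
Proof.
have symp := fconnect_sym (@perm_inj _ p).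
case: (@arg_minnP _ x (fun k => k \in fingraph.orbit p x) val (in_orbit _ _)).
move=> k; rewrite -fconnect_orbit => xk kmin.
exists k; last by rewrite -fconnect_orbit symp.
apply/forall_inP => l; rewrite -fconnect_orbit => kl; apply: kmin.
by rewrite -fconnect_orbit (connect_trans xk).
Qed.

Lemma mem_cycle_mins p k :
  (k \in [seq k <- enum 'I_n | cycle_min p k]) = cycle_min p k.
Proof. by rewrite mem_filter mem_enum andbT. Qed.

Lemma perm_flatten_ord_cycle_form p :
  perm_eq (flatten (ord_cycle_form p)) (enum 'I_n).
Proof.
apply: uniq_perm (enum_uniq _) _.
  apply: uniq_flatten_map; first by rewrite filter_uniq ?enum_uniq.
    by move=> k _; exact: orbit_uniq.
  by move=> k l; rewrite !mem_cycle_mins => km lm x; exact: cycle_min_inj.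
move=> x; rewrite mem_enum; apply/flattenP.
have [k km xk] := cycle_min_ex p x; exists (fingraph.orbit p k) => //.
by apply/mapP; exists k; rewrite ?mem_cycle_mins.
Qed.

(** Each orbit has exactly one minimal element, which represents it in the form. *)
Lemma size_cycle_form p : size (cycle_form p) = mu p.
Proof.
rewrite cycle_formE !size_map /mu.
set s := filter _ _; have Us : uniq s by rewrite filter_uniq ?enum_uniq.
have porbitE k x : (x \in porbit p k) = (x \in fingraph.orbit p k).
  rewrite -fconnect_orbit; apply/porbitP/idP => [[i ->]|/iter_findex <-].
    by rewrite permX fconnect_iter.
  by exists (findex p k x); rewrite permX.
have -> : porbits p = [set porbit p k | k in s].
  apply/setP => A; apply/imsetP/imsetP => -[k ks ->]; last by exists k.
  have [l lm kl] := cycle_min_ex p k; exists l; first by rewrite mem_cycle_mins.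
  by apply/eqP; rewrite eq_porbit_mem porbitE.
rewrite card_in_imset; first by apply/esym/card_uniqP.
move=> k l; rewrite !mem_cycle_mins => km lm /setP/(_ k).
by rewrite !porbitE in_orbit => /esym; apply: cycle_min_inj (in_orbit _ _).
Qed.

Lemma std_form_cycle_form p : derangement p -> std_form n (cycle_form p).
Proof.
move=> /forallP dp; rewrite cycle_formE; apply/and3P; split.
- apply/allP => _ /mapP[_ /mapP[k km ->] ->]; rewrite mem_cycle_mins in km.
  rewrite size_map size_orbit.
  (* An orbit of size one would be a fixed point. *)
  have := orderSpred p k; case: _.-1 => [|m] ordk.
    have := iter_order (@perm_inj _ p) k; rewrite -ordk /= => /eqP.
    by rewrite (negPf (dp k)).
  rewrite -ordk /=; apply/allP => _ /mapP[l lk ->].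
  rewrite /fingraph.orbit -ordk /= ltnS.
  by move/forall_inP: km; apply.
- rewrite -!map_comp.
  have -> : map (head 0 \o (map (fun l : 'I_n => l.+1) \o fingraph.orbit p))
      [seq k <- enum 'I_n | cycle_min p k] =
      map (succn \o val) [seq k <- enum 'I_n | cycle_min p k].
    by apply: eq_map => k /=; rewrite /fingraph.orbit -orderSpred.
  rewrite map_comp (@mono_sorted _ _ succn ltn ltn) //.
  rewrite sorted_map; apply: sorted_filter.
    by move=> a b c /=; exact: ltn_trans.
  rewrite -(@sorted_map _ _ (@nat_of_ord n) ltn) val_enum_ord.
  exact: iota_ltn_sorted.
- rewrite -map_flatten (permPl (perm_map _ (perm_flatten_ord_cycle_form p))).
  rewrite (_ : map _ _ = map succn (map val (enum 'I_n))); last first.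
    by rewrite -map_comp.
  by rewrite val_enum_ord -(iotaDl 1 0 n).
Qed.

(** The image of [x] is its cyclic successor in the block containing it, so it can be read off the
    form. *)
Lemma cycle_form_inj : injective (@cycle_form n).
Proof.
move=> p q; rewrite !cycle_formE.
have inj : injective (fun l : 'I_n => l.+1) by move=> a b [/val_inj].
move/(inj_map (inj_map inj)) => pq; apply/permP => x.
have nextp (r : {perm 'I_n}) c :
    c \in ord_cycle_form r -> x \in c -> r x = next c x.
  move=> /mapP[k _ ->] xk; apply/eqP; apply: (@next_cycle _ (frel r)) xk.
  exact/cycle_orbit/perm_inj.
have : x \in flatten (ord_cycle_form p).
  by rewrite (perm_mem (perm_flatten_ord_cycle_form p)) mem_enum.
case/flattenP => c cp xc; rewrite (nextp p c) // (nextp q c) //.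
by rewrite -pq.
Qed.

End CycleForm.

(* The permutation sends each letter to the next one in its cycle. *)
Lemma std_form_ex n cs : std_form n cs ->
  exists2 p : {perm 'I_n}, derangement p & cycle_form p = cs.
Proof.
case: n => [|n] sf.
  (* Size zero is separate because [inord] below needs an inhabited ordinal type. *)
  exists 1%g; first by apply/forallP => -[].
  rewrite /cycle_form (size0nil (s := enum 'I_0)) ?size_enum_ord //=.
  case: cs sf => // c cs /and3P[/= /andP[/andP[c1 _] _] _ /perm_size].
  by rewrite size_cat /=; lia.
have le_cs c l : c \in cs -> l \in c -> 0 < l <= n.+1.
  by move=> cin lin; rewrite -(std_form_mem l sf); apply/flattenP; exists c.
pose ds : seq (seq 'I_n.+1) := map (map (fun l => inord l.-1)) cs.
have dsE : cs = map (map (fun l : 'I_n.+1 => l.+1)) ds.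
  rewrite -map_comp map_id_in // => c cin /=; rewrite -map_comp map_id_in //.
  by move=> l lin /=; have := le_cs c l cin lin => ?; rewrite inordK; lia.
have inj : injective (fun l : 'I_n.+1 => l.+1) by move=> a b [/val_inj].
move/and3P: (sf) => [cyc srt _].
have Uds : uniq (flatten ds).
  by have := std_form_uniq sf; rewrite dsE -map_flatten map_inj_uniq.
have Uc c : c \in ds -> uniq c.
  move=> cin; elim: (ds) Uds cin => //= e ss IH; rewrite cat_uniq inE.
  by move=> /and3P[Ue _ Uss] /predU1P[->|/IH]; last exact.
have mds x : x \in flatten ds.
  have := std_form_mem x.+1 sf; rewrite dsE -map_flatten mem_map // => ->.
  exact: ltn_ord.
have cds c : c \in ds ->
    1 < size c /\ {in c, forall l : 'I_n.+1, head ord0 c <= l}.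
  move=> cin; have : map (fun l : 'I_n.+1 => l.+1) c \in cs.
    by rewrite dsE; exact: map_f.
  move/(allP cyc); rewrite size_map => /andP[c1 /allP cmin]; split=> // l lc.
  have := cmin l.+1; rewrite mem_map // => /(_ lc).
  by case: (c) c1.
have hds c : c \in ds -> head ord0 c \in c.
  by case/cds; case: (c) => //= a e _ _; rewrite mem_head.
pose f x := next (nth [::] ds (find (fun c => x \in c) ds)) x.
have fE c x : c \in ds -> x \in c -> f x = next c x.
  move=> cin xc; have hasx : has (fun c => x \in c) ds by apply/hasP; exists c.
  congr (next _ x); apply: flatten_block_inj Uds _ cin _ xc.
    by rewrite mem_nth -?has_find.
  exact: (nth_find [::] hasx).
have f_inj : injective f.
  move=> x y; have /flattenP[c cin xc] := mds x; have /flattenP[d din yd] := mds y.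
  rewrite (fE c) // (fE d) // => nxy.
  have cd : c = d.
    apply: (@flatten_block_inj _ ds c d (next c x)) => //.
      by rewrite mem_next.
    by rewrite nxy mem_next.
  by apply: (can_inj (prev_next (Uc c cin))); rewrite nxy cd.
pose p := perm f_inj.
have cycp c : c \in ds -> fcycle p c.
  move=> cin; apply: (@sub_in_cycle _ (mem c) (frel (next c))).
  - by move=> x y xc _ /= /eqP <-; rewrite permE (fE c).
  - exact/allP.
  - exact/cycle_next/Uc.
have orbp c : c \in ds -> fingraph.orbit p (head ord0 c) = c.
  move=> cin; rewrite (fingraph.orbitE (cycp c cin) (Uc c cin) (hds c cin)).
  by case/cds: cin; case: (c) => //= a e _ _; rewrite eqxx rot0.
exists p.
  apply/forallP => x; have /flattenP[c cin xc] := mds x; apply/negP => px.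
  have : fcycle p [:: x] by rewrite /= px.
  move/order_le_cycle => /(_ x (mem_head _ _)).
  rewrite (fingraph.order_cycle (cycp c cin) (Uc c cin) xc) /=.
  by have [c1 _] := cds c cin; rewrite leqNgt c1.
rewrite cycle_formE dsE; congr map; rewrite /ord_cycle_form.
(* Both lists are strictly increasing, so it is enough that they have the same elements. *)
have -> : [seq k <- enum 'I_n.+1 | cycle_min p k] = map (head ord0) ds.
  apply: (@irr_sorted_eq _ (fun a b : 'I_n.+1 => a < b)).
  - by move=> a b c; exact: ltn_trans.
  - by move=> a; rewrite ltnn.
  - apply: sorted_filter; first by move=> a b c; exact: ltn_trans.
    by rewrite -(@sorted_map _ _ (@nat_of_ord n.+1) ltn) val_enum_ord iota_ltn_sorted.
  - move: srt; rewrite dsE -map_comp.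
    have -> : map (head 0 \o map (fun l : 'I_n.+1 => l.+1)) ds =
        map (succn \o (@nat_of_ord _)) (map (head ord0) ds).
      rewrite -map_comp; apply/eq_in_map => c /cds[c1 _] /=.
      by case: (c) c1.
    by rewrite [X in sorted _ X]map_comp (@mono_sorted _ _ succn ltn ltn) // sorted_map.
  have minh c : c \in ds -> cycle_min p (head ord0 c).
    by move=> cin; apply/forall_inP; rewrite orbp //; case/cds: cin.
  move=> k; rewrite mem_cycle_mins; apply/idP/mapP => [km|[c cin ->]]; last exact: minh.
  have /flattenP[c cin kc] := mds k; exists c => //.
  by apply: (cycle_min_inj km (minh c cin) (in_orbit _ k)); rewrite orbp.
by rewrite -map_comp map_id_in // => c /orbp.
Qed.

(** * Recurrences *)

Definition good_forms n : seq (seq (seq nat)) :=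
  [seq cycle_form p | p <- enum (D_3_21 n)].

Lemma good_forms_uniq n : uniq (good_forms n).
Proof. by rewrite map_inj_uniq ?enum_uniq //; exact: cycle_form_inj. Qed.

Lemma mem_good_forms n cs : (cs \in good_forms n) = good n cs.
Proof.
apply/mapP/andP => [[p]|[sf av]].
  by rewrite mem_enum inE => /andP[dp av] ->; rewrite std_form_cycle_form.
have [p dp pcs] := std_form_ex sf; exists p => //.
by rewrite mem_enum inE dp /flat pcs.
Qed.

Lemma good_rcons n cs c : good n (rcons cs c) ->
  [/\ 1 < size c, {in c, forall a, head 0 c <= a}, head 0 c < last 0 c &
      0 < head 0 c /\ last 0 c <= n].
Proof.
case/andP=> sf _; move/and3P: (sf) => [].
rewrite all_rcons => /andP[/andP[c1 /allP cmin] _] _ _.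
have c_in a : a \in c -> 0 < a <= n.
  by move=> ac; rewrite -(std_form_mem a sf) flatten_rcons mem_cat ac orbT.
have := std_form_uniq sf; rewrite flatten_rcons cat_uniq => /and3P[_ _].
case: c c1 cmin c_in {sf} => [|a [|b c]] //= _ cmin c_in /andP[ac _].
have lc : last b c \in b :: c by rewrite mem_last.
have /c_in/andP[_ ln] : last b c \in a :: b :: c by rewrite inE lc orbT.
have /c_in/andP[a0 _] := mem_head a (b :: c).
split=> //; rewrite ltn_neqAle; apply/andP; split.
  by apply: contraNneq ac => ->.
by apply: cmin; rewrite inE lc orbT.
Qed.

Fixpoint map_last (T : Type) (f : T -> T) (s : seq T) : seq T :=
  match s with
  | [::] => [::]
  | [:: x] => [:: f x]
  | x :: s' => x :: map_last f s'
  end.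

Lemma map_last_rcons (T : Type) (f : T -> T) s x :
  map_last f (rcons s x) = rcons s (f x).
Proof. by elim: s => //= y s ->; case: s. Qed.

(** The inverse of deleting the last letter [j] and closing the gap it leaves. *)
Definition append_letter j (cs : seq (seq nat)) : seq (seq nat) :=
  map_last (rcons^~ j) (map (map (bump j)) cs).

Lemma append_letter_rcons j cs c : append_letter j (rcons cs c) =
  rcons (map (map (bump j)) cs) (rcons (map (bump j) c) j).
Proof. by rewrite /append_letter map_rcons map_last_rcons. Qed.

(** The last letter leaves its cycle to form a 2-cycle with [j]; the flattened word is the same as
    for [append_letter j]. *)
Definition append_cycle j (cs : seq (seq nat)) : seq (seq nat) :=
  let ds := map (map (bump j)) cs in
  rcons (map_last (fun c => take (size c).-1 c) ds)
        [:: last 0 (last [::] ds); j].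

Lemma append_cycle_rcons j cs c i : append_cycle j (rcons cs (rcons c i)) =
  rcons (rcons (map (map (bump j)) cs) (map (bump j) c)) [:: bump j i; j].
Proof.
rewrite /append_cycle !map_rcons map_last_rcons !last_rcons size_rcons.
by congr (rcons (rcons _ _) _); rewrite -cats1 take_size_cat.
Qed.

Lemma map_bump_inj j : injective (map (bump j)).
Proof. exact/inj_map/can_inj/bumpK. Qed.

Definition from_to i j (cs : seq (seq nat)) :=
  (head 0 (last [::] cs) == i) && (last 0 (last [::] cs) == j).

(** The coefficient of y^m in r_{n,i,j} as a natural number, see [coef_r_poly]; likewise [ns] for
    s_{n,i,j}. *)
Definition nr m n i j :=
  count (fun cs => from_to i j cs && (size cs == m)) (good_forms n).

Definition ns m n i j :=
  count (fun cs => [&& from_to i j cs, 2 < size (last [::] cs) & size cs == m])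
        (good_forms n).

Lemma countE (T : Type) (a : pred T) s : count a s = \sum_(x <- s) a x.
Proof. by rewrite -sum1_count big_mkcond; apply: eq_bigr => x _; case: (a x). Qed.

Lemma sum_eq_nat e a b : \sum_(a <= k < b) (e == k) = (a <= e < b).
Proof.
rewrite -mem_index_iota -count_uniq_mem ?iota_uniq // countE.
by apply: eq_bigr => k _; rewrite eq_sym.
Qed.

Lemma count_map_in (S T : eqType) (f : S -> T) (a : pred S) (b : pred T) s t :
    uniq s -> uniq t -> {in [pred x | (x \in s) && a x] &, injective f} ->
    (forall y, (y \in t) && b y -> exists2 x, (x \in s) && a x & y = f x) ->
    (forall x, (x \in s) && a x -> (f x \in t) && b (f x)) ->
  count b t = count a s.
Proof.
move=> Us Ut f_inj sur into; rewrite -!size_filter -(size_map f).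
apply/perm_size/uniq_perm; first by rewrite filter_uniq.
  rewrite map_inj_in_uniq ?filter_uniq // => x y.
  by rewrite !mem_filter ![a _ && _]andbC => xs ys; apply: f_inj.
move=> y; rewrite mem_filter andbC; apply/idP/mapP => [/sur[x xs ->]|[x]].
  by exists x; rewrite // mem_filter andbC.
by rewrite mem_filter andbC => /into ? ->.
Qed.

(** [append_letter j] is a bijection from the forms of size [n] whose last letter is below [j] or
    equal to [n], and it preserves the head of the last cycle and the number of cycles. *)
Lemma ns_rec m n i j : 0 < i -> i < j <= n.+1 ->
  ns m n.+1 i j = \sum_(i.+1 <= k < j) nr m n i k + (j <= n) * nr m n i n.
Proof.
move=> i0 /andP[ij jn].
pose Q cs := [&& head 0 (last [::] cs) == i, size cs == m &
  (last 0 (last [::] cs) < j) || (last 0 (last [::] cs) == n)].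
transitivity (count Q (good_forms n)).
  apply: (@count_map_in _ _ (append_letter j)); rewrite ?good_forms_uniq //.
  - move=> cs ds; rewrite !inE.
    case/lastP: cs => [/and3P[_ /eqP/= /esym]|cs c _]; first by lia.
    case/lastP: ds => [/and3P[_ /eqP/= /esym]|ds d _]; first by lia.
    rewrite !append_letter_rcons => /rcons_inj[/(inj_map (@map_bump_inj j)) -> ].
    by move=> /rcons_inj[/map_bump_inj ->].
  - move=> cs; case/lastP: cs => [/and3P[_ /andP[/eqP/= /esym]]|cs c]; first by lia.
    rewrite /from_to last_rcons mem_good_forms size_rcons.
    case/and4P => + /andP[/eqP hc /eqP lc] c3 sz.
    case/lastP: c hc lc c3 => // c j'; rewrite last_rcons size_rcons ltnS.
    move=> hc jE c2 gd; subst j'.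
    rewrite head_rcons_size in hc; last by lia.
    have [cs' [c' [csE cE]]] := good_rcons_bumpE gd.
    exists (rcons cs' c'); last by rewrite append_letter_rcons -csE -cE.
    have hc' : head 0 c' = i.
      by move: hc; rewrite cE head_map_bump; rewrite /bump; lia.
    move: gd; rewrite csE cE good_rcons_bump; last by lia.
      move=> /andP[gd lc]; rewrite mem_good_forms gd /Q last_rcons hc' eqxx lc.
      by move: sz; rewrite csE size_map size_rcons => ->.
    by rewrite cE size_map in c2.
  - move=> cs; case/lastP: cs => [/and3P[_ /eqP/= /esym]|cs c]; first by lia.
    rewrite /Q last_rcons => /and4P[]; rewrite mem_good_forms.
    move=> gd /eqP hc sz lc; have [c1 _ _ _] := good_rcons gd.
    rewrite append_letter_rcons mem_good_forms good_rcons_bump //; last by lia.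
    rewrite gd lc /from_to last_rcons last_rcons head_rcons_size ?size_map; last by lia.
    rewrite head_map_bump; last by lia.
    rewrite size_rcons size_map ltnS c1 size_rcons size_map eqxx.
    by rewrite size_rcons in sz; rewrite sz hc /bump; lia.
under eq_bigr do rewrite /nr countE.
rewrite exchange_big /= /nr !countE big_distrr -big_split /=.
rewrite big_seq [RHS]big_seq; apply: eq_bigr => cs.
rewrite mem_good_forms /Q /from_to.
case/lastP: cs => [_ |cs c /good_rcons[_ _ + []]].
  by rewrite /= (ltn_eqF i0) muln0 big1.
rewrite last_rcons; move: (head 0 c) (last 0 c) => h e he h0 en.
case: (eqVneq h i) => [hi|_]; last by rewrite /= muln0 big1.
case: (_ == m); last by rewrite andbF muln0 big1 // => k _; rewrite andbF.
under eq_bigr do rewrite andbT; rewrite sum_eq_nat /= andbT; subst h.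
(* The factor [j <= n] prevents a form with last letter [n] from being counted twice when [j] is
   [n.+1]. *)
by move: he en; case: (eqVneq e n); case: (leqP j n); case: (leqP j e); lia.
Qed.

(** [append_cycle j] is a bijection onto the forms ending in the 2-cycle (i j). Since [i < j], the
    letter [i] is not raised and the last step of the word is an ascent, so avoidance imposes no
    further condition. *)
Lemma nr_rec m n i j : 1 < n -> 0 < i -> i < j <= n.+1 ->
  nr m.+1 n.+1 i j = ns m.+1 n.+1 i j + \sum_(1 <= k < i) ns m n k i.
Proof.
move=> n1 i0 /andP[ij jn].
pose P cs := [&& from_to i j cs, size (last [::] cs) <= 2 & size cs == m.+1].
pose Q cs := [&& last 0 (last [::] cs) == i, 2 < size (last [::] cs) & size cs == m].
transitivity (ns m.+1 n.+1 i j + count P (good_forms n.+1)).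
  rewrite /nr /ns !countE -big_split; apply: eq_bigr => cs _ /=.
  by rewrite /P ltnNge; case: from_to; case: (_ <= 2); case: (_ == _).
congr (_ + _); transitivity (count Q (good_forms n)).
  apply: (@count_map_in _ _ (append_cycle j)); rewrite ?good_forms_uniq //.
  - move=> cs ds; rewrite !inE.
    case/lastP: cs => [/and3P[_ /eqP/= /esym]|cs c]; first by lia.
    case/lastP: ds => [_ /and3P[_ /eqP/= /esym]|ds d]; first by lia.
    rewrite /Q !last_rcons => /and4P[_ _ c3 _] /and4P[_ _ d3 _].
    case/lastP: c c3 => // c a _; case/lastP: d d3 => // d b _.
    rewrite !append_cycle_rcons => /rcons_inj[].
    move=> /rcons_inj[/(inj_map (@map_bump_inj j)) -> /map_bump_inj ->].
    by move/(can_inj (bumpK j)) ->.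
  - move=> cs; rewrite mem_good_forms /P /from_to.
    case/lastP: cs => [/and3P[_ /andP[/eqP/= /esym]]|cs c]; first by lia.
    rewrite last_rcons size_rcons eqSS => /and4P[gd /andP[hc lc] c2 sz].
    have [c1 _ _ _] := good_rcons gd.
    have {c1 c2} cE : c = [:: i; j].
      by move: c hc lc c1 c2 {gd} => [|a [|b [|? ?]]] //= /eqP -> /eqP ->.
    subst c.
    (* If (i j) were the only cycle, [n.+1] would be 2, against [1 < n]. *)
    case/lastP: cs gd sz {hc lc} => [|cs c] gd sz.
      case/andP: gd => /and3P[_ _ /perm_size]; rewrite size_iota /=; lia.
    have c1 : 1 < size c.
      case/andP: gd => /and3P[]; rewrite !all_rcons.
      by case/and3P=> _ /andP[].
    rewrite good_split // in gd.
    have [cs' [c' [csE cE]]] := good_rcons_bumpE gd.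
    case/lastP: c' cE => [|c' i']; first by case: (c).
    rewrite map_rcons => /rcons_inj[cE iE].
    have {iE} i'E : i' = i by move: iE; rewrite /bump; lia.
    subst i'; exists (rcons cs' (rcons c' i)); last first.
      by rewrite append_cycle_rcons -csE -cE /bump leqNgt ij.
    have hi : head 0 c <= i.
      have [_ /(_ i) + _ _] := good_rcons gd.
      rewrite mem_rcons inE mem_rcons mem_head orbT => /(_ isT).
      by rewrite !head_rcons_size ?size_rcons // ltnW.
    have c'1 : 1 < size c' by rewrite cE size_map in c1.
    have gdE : good n.+1 (rcons (map (map (bump j)) cs')
        (rcons (map (bump j) (rcons c' i)) j)).
      by rewrite map_rcons -csE -cE /bump leqNgt ij.
    rewrite good_rcons_bump in gdE.
    + case/andP: gdE => gdE _; rewrite mem_good_forms gdE /Q !last_rcons eqxx.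
      by rewrite !size_rcons; move: sz; rewrite csE !size_rcons size_map; lia.
    + by rewrite size_rcons; lia.
    + rewrite head_rcons_size; last by lia.
      by move: hi; rewrite cE head_map_bump; rewrite /bump; lia.
  - move=> cs; rewrite mem_good_forms /Q.
    case/lastP: cs => [/and3P[_ /eqP/= /esym]|cs c]; first by lia.
    rewrite last_rcons size_rcons => /and4P[gd /eqP lc c3 sz].
    have [_ _ hl [h0 ln]] := good_rcons gd.
    case/lastP: c lc c3 hl gd h0 {ln} => // c i'; rewrite last_rcons => iE.
    subst i'; rewrite size_rcons ltnS => c2 hl gd h0.
    have bi : bump j i = i by rewrite /bump leqNgt ij.
    rewrite append_cycle_rcons mem_good_forms bi good_split ?size_map //.
    have hj : head 0 (rcons c i) < j <= n.+1 by rewrite (ltn_trans hl ij).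
    rewrite -{1}bi -map_rcons good_rcons_bump ?size_rcons ?ltnS ?(ltnW c2) //.
    rewrite gd last_rcons ij /P /from_to last_rcons /= !eqxx.
    by move: sz; rewrite !size_rcons size_map; lia.
under eq_bigr do rewrite /ns countE.
rewrite exchange_big /= !countE big_seq [RHS]big_seq; apply: eq_bigr => cs.
rewrite mem_good_forms /Q /from_to.
case/lastP: cs => [_ |cs c /good_rcons[_ _ + []]].
  by rewrite /= !andbF big1 // => k _; rewrite andbF.
rewrite last_rcons; move: (head 0 c) (last 0 c) => h e he h0 en.
case: (eqVneq e i) => [ei|_]; last first.
  by rewrite /= big1 // => k _; rewrite andbF.
case: (2 < _) => /=; last by rewrite big1 // => k _; rewrite andbF.
case: (_ == m); last by rewrite big1 // => k _; rewrite andbF.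
by under eq_bigr do rewrite !andbT; rewrite sum_eq_nat; lia.
Qed.

Lemma ns0 n i j : ns 0 n i j = 0.
Proof.
rewrite /ns -[RHS](count_pred0 (good_forms n)); apply: eq_count => -[|c cs].
  by rewrite /= andbF.
by apply/negbTE/negP => /and3P[].
Qed.

Lemma nr_2_1_2 m : nr m 2 1 2 = (m == 1).
Proof.
have -> : nr m 2 1 2 = count (fun cs => size cs == m) [:: [:: [:: 1; 2]]].
  apply: (@count_map_in _ _ id); rewrite ?good_forms_uniq //.
  - move=> cs /andP[]; rewrite mem_good_forms => /andP[/and3P[al _ pe] _].
    case/andP=> _ sz; exists cs => //; rewrite sz andbT inE.
    have := perm_size pe; have := perm_mem pe.
    case: cs al pe {sz} => [|c [|d cs]] //=; last first.
      by rewrite !size_cat => /and3P[/andP[? _] /andP[? _] _]; lia.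
    case: c => [|a [|b [|? ?]]] //=; rewrite ?size_cat /=; try lia.
    rewrite !andbT leqnn /= => ab /perm_uniq /=; rewrite !inE.
    move=> nab mab _; have := mab a; have := mab b; rewrite !inE !eqxx orbT /=.
    move=> /esym bE /esym aE; rewrite andbT in nab; apply/eqP.
    by congr [:: [:: _; _]]; lia.
  - move=> cs; rewrite inE andbC => /andP[sz /eqP csE]; rewrite csE in sz *.
    rewrite mem_good_forms sz andbT; apply/andP; split; last by [].
    rewrite /good; apply/andP; split; first by [].
    by apply/contains_3_21P => -[i [j [/=]]]; lia.
by rewrite /= addn0 eq_sym.
Qed.

Import GRing.Theory.
Local Open Scope ring_scope.

Lemma coef_r_poly (K : nzRingType) m n i j :
  (r_poly K n i j)`_m = (nr m n i j)%:R.
Proof.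
rewrite /r_poly coef_sum /nr countE big_map natr_sum big_enum /= big_mkcondr.
apply: eq_bigr => p _; rewrite /last_cycle_from_to /from_to -/(last_cycle p).
by rewrite size_cycle_form coefXn [m == _]eq_sym; case: (_ && (_ == j)).
Qed.

Lemma coef_s_poly (K : nzRingType) m n i j :
  (s_poly K n i j)`_m = (ns m n i j)%:R.
Proof.
rewrite /s_poly coef_sum /ns countE big_map natr_sum big_enum /= big_mkcondr.
apply: eq_bigr => p _; rewrite /last_cycle_from_to /from_to -/(last_cycle p).
by rewrite size_cycle_form coefXn [m == _]eq_sym andbA; case: (_ && (2 < _)%N).
Qed.

(** * Formal power series *)

Section Slices.
Variable A : comNzRingType.
Implicit Types (a b : A) (c : nat -> nat -> nat -> nat) (r : nat -> A).

(** The factor of x^n in [gf]; when a and b are themselves series in x this is not the coefficient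
    of x^n, but [gf_natr] still applies. *)
Definition slice c n a b : A :=
  \sum_(1 <= i < n) a ^+ (n - 1 - i)%N *
    \sum_(i.+1 <= j < n.+1) (c n i j)%:R * b ^+ (n - j)%N.

Lemma geometric_sum b k N : (k <= N)%N ->
  (1 - b) * (\sum_(k <= j < N) b ^+ (N - j.+1)%N) = 1 - b ^+ (N - k)%N.
Proof.
move=> kN; have /= := telescope_sumr (fun j => b ^+ (N - j)%N) kN.
rewrite subnn expr0 => <-; rewrite mulr_sumr.
apply: eq_big_nat => j /andP[_ jN]; rewrite -[in RHS](subnSK jN) exprS.
by rewrite mulrBl mul1r.
Qed.

(* Summation by parts. *)
Lemma geometric_partial_sums b r i n : (i < n)%N ->
  (1 - b) * (\sum_(i.+1 <= j < n.+2)
      (\sum_(i.+1 <= k < j) r k + (j <= n)%:R * r n) * b ^+ (n.+1 - j)%N)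
  = \sum_(i.+1 <= k < n.+1) r k
    - b * (\sum_(i.+1 <= k < n.+1) r k * b ^+ (n - k)%N)
    + b * r n * (1 - b ^+ (n - i)%N).
Proof.
move=> lt_in; under eq_bigr do rewrite mulrDl.
rewrite big_split /= mulrDr; congr (_ + _).
  (* The increments of [f] combine (1-b) times the partial sums with the terms [r j] themselves. *)
  pose f j := (\sum_(i.+1 <= k < j) r k) * b ^+ (n.+2 - j)%N.
  have lt_in2 : (i.+1 <= n.+2)%N by lia.
  have := telescope_sumr f lt_in2.
  have -> : f i.+1 = 0 by rewrite /f big_geq ?mul0r.
  have -> : f n.+2 = \sum_(i.+1 <= k < n.+1) r k + r n.+1.
    by rewrite /f subnn expr0 mulr1 big_nat_recr //=; lia.
  rewrite subr0.
  have -> : \sum_(i.+1 <= k < n.+2) (f k.+1 - f k) =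
    (1 - b) * (\sum_(i.+1 <= j < n.+2)
      (\sum_(i.+1 <= k < j) r k) * b ^+ (n.+1 - j)%N)
    + \sum_(i.+1 <= j < n.+2) r j * b ^+ (n.+1 - j)%N.
    rewrite mulr_sumr -big_split; apply: eq_big_nat => j /andP[ij jn] /=.
    rewrite /f big_nat_recr //= subSS.
    by rewrite (_ : n.+2 - j = (n.+1 - j).+1)%N ?exprS; [ring | lia].
  rewrite [X in _ + X = _]big_nat_recr /=; last by lia.
  rewrite subnn expr0 mulr1 addrA => /addIr <-.
  rewrite [X in _ = _ - X]mulr_sumr.
  under [X in _ = _ - X]eq_big_nat => j /andP[ij jn].
    by rewrite mulrCA -exprS -subSn //; over.
  by rewrite addrK.
rewrite big_nat_recr /=; last by lia.
rewrite ltnn !mul0r addr0.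
have := @geometric_sum b i.+1 n.+1 (ltnW lt_in); rewrite subSS => <-.
rewrite !mulr_sumr; apply: eq_big_nat => j /andP[ij jn].
by rewrite -ltnS jn mul1r subSn // exprS subSS; ring.
Qed.

(** For each [i], [ns_rec] is summed by [geometric_partial_sums]. The separate term [nr m n i n]
    produces the slices at b = 0, where only the last letter [n] survives. *)
Lemma slice_ns m n a b :
  (1 - b) * slice (ns m) n.+1 a b =
  a * (slice (nr m) n a 1 - b * slice (nr m) n a b) +
  a * b * (slice (nr m) n a 0 - b * slice (nr m) n (a * b) 0).
Proof.
rewrite /slice; case: n => [|n].
  by rewrite !big_geq //; ring.
(* The left side has one more index i than the right; its last cycle would start at the second
   largest letter, too late for length three. *)
have top : \sum_(n.+2 <= j < n.+3) (ns m n.+2 n.+1 j)%:R * b ^+ (n.+2 - j)%N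
    = 0.
  rewrite big_nat1 ns_rec ?leqnn ?ltnS //= big_geq // ltnn.
  by rewrite mul0n addn0 mul0r.
rewrite [in LHS]big_nat_recr //= top mulr0 addr0.
rewrite !mulr_sumr -!sumrB !mulr_sumr -big_split; apply: eq_big_nat => i.
case/andP=> i0 lt_in /=.
have in0 : \sum_(i.+1 <= j < n.+2) (nr m n.+1 i j)%:R * 0 ^+ (n.+1 - j)%N
    = (nr m n.+1 i n.+1)%:R :> A.
  rewrite big_nat_recr //= subnn mulr1 big_nat_cond big1 ?add0r // => j.
  by case/andP=> /andP[_ jn] _; rewrite expr0n subn_eq0 leqNgt jn mulr0.
rewrite in0; under [in X in a * (X - _)]eq_bigr do rewrite expr1n mulr1.
have -> : \sum_(i.+1 <= j < n.+3) (ns m n.+2 i j)%:R * b ^+ (n.+2 - j)%N =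
  \sum_(i.+1 <= j < n.+3) (\sum_(i.+1 <= k < j) (nr m n.+1 i k)%:R
     + (j <= n.+1)%:R * (nr m n.+1 i n.+1)%:R) * b ^+ (n.+2 - j)%N :> A.
  apply: eq_big_nat => j /andP[ij jn]; rewrite ns_rec //; last by rewrite ij.
  by rewrite natrD natr_sum natrM.
rewrite mulrCA geometric_partial_sums // exprMn.
have -> : (n.+2 - 1 - i = (n.+1 - 1 - i).+1)%N by lia.
rewrite !exprS.
by ring.
Qed.

Lemma exchange_triangle (G : nat -> nat -> A) n :
  \sum_(1 <= i < n.+1) \sum_(1 <= k < i) G k i =
  \sum_(1 <= k < n) \sum_(k.+1 <= i < n.+1) G k i.
Proof.
elim: n => [|n IHn]; first by rewrite !big_geq.
rewrite big_nat_recr //= IHn; case: n {IHn} => [|n]; first by rewrite !big_geq ?addr0.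
have -> : \sum_(1 <= k < n.+1) \sum_(k.+1 <= i < n.+2) G k i =
    \sum_(1 <= k < n.+2) \sum_(k.+1 <= i < n.+2) G k i.
  by rewrite [RHS]big_nat_recr //= [X in _ + X]big_geq ?addr0.
rewrite -big_split; apply: eq_big_nat => k /andP[k0 kn] /=.
by rewrite [RHS]big_nat_recr.
Qed.

(** By [nr_rec] the summand depends on [j] only through a power of b, so the sum over [j] is
    geometric. The start [i] of the 2-cycle is the last letter of the shorter form, which is why a
    moves to the second argument, the first one becoming 1. *)
Lemma slice_nr m n a b : (1 < n)%N ->
  (1 - b) * (slice (nr m.+1) n.+1 a b - slice (ns m.+1) n.+1 a b) =
  slice (ns m) n 1 a - b * slice (ns m) n 1 (a * b).
Proof.
move=> n1; rewrite /slice -sumrB [LHS]mulr_sumr.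
transitivity (\sum_(1 <= i < n.+1) \sum_(1 <= k < i)
    (ns m n k i)%:R * (a ^+ (n - i)%N * (1 - b ^+ (n.+1 - i)%N))).
  apply: eq_big_nat => i /andP[i0 lt_in].
  rewrite -mulr_suml -natr_sum.
  have := @geometric_sum b i.+1 n.+2 (ltnW lt_in); rewrite subSS => <-.
  rewrite -mulrBr -sumrB !mulr_sumr; apply: eq_big_nat => j /andP[ij jn].
  rewrite nr_rec //; last by rewrite ij.
  by rewrite natrD !subSS subn0; ring.
rewrite exchange_triangle mulr_sumr -sumrB; apply: eq_big_nat => k /andP[k0 kn].
rewrite !expr1n !mul1r mulr_sumr -sumrB; apply: eq_big_nat => i /andP[ki lt_in].
by rewrite exprMn subSn // exprS; ring.
Qed.

Lemma slice1 c a b : slice c 1 a b = 0.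
Proof. by rewrite /slice big_geq. Qed.

Lemma slice0 c a b : slice c 0 a b = 0.
Proof. by rewrite /slice big_geq. Qed.

(** The initial value behind the Kronecker delta: the single cycle (1 2). *)
Lemma slice_nr2 m a b :
  slice (nr m.+1) 2 a b - slice (ns m.+1) 2 a b = (m == 0)%:R.
Proof.
rewrite /slice !big_nat1 nr_2_1_2 ns_rec // big_geq //=.
by rewrite mul0n !mul1r !mulr1 subr0 eqSS.
Qed.

End Slices.

(* Locked: otherwise unification unfolds it down to coefficients. *)
HB.lock Definition xsum (K : comUnitRingType) (H : nat -> fps K) : fps K :=
  \fsum_n (H n * fpsX ^+ n).

(** * Sums of series multiplied by growing powers of x *)

Section PowerSeries.
Variable K : comUnitRingType.
Implicit Types (f g : fps K) (H : nat -> fps K).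

Lemma coef_fpsXM0 f : (fpsX * f) 0%N = 0.
Proof. by rewrite coef_fpsM big_ord1 mul0r. Qed.

Lemma coef_fpsXMS f n : (fpsX * f) n.+1 = f n.
Proof.
rewrite coef_fpsM big_ord_recl /= mul0r add0r big_ord_recl /= mul1r.
by rewrite subSS subn0 big1 ?addr0 // => i _; rewrite mul0r.
Qed.

Lemma coef_fpsXnM k f n : (n < k)%N -> (fpsX ^+ k * f) n = 0.
Proof.
elim: k n => // k IHk [|n] kn; rewrite exprS -mulrA ?coef_fpsXM0 //.
by rewrite coef_fpsXMS IHk.
Qed.

Lemma fpsXM_inj : injective (fun f => fpsX * f).
Proof.
move=> f g /fpsP fg; apply/fpsP => n.
by rewrite -[LHS]coef_fpsXMS fg coef_fpsXMS.
Qed.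

Lemma coef_fpsCM c f n : (fpsC c * f) n = c * f n.
Proof.
by rewrite coef_fpsM big_ord_recl subn0 big1 ?addr0 // => i _; rewrite mul0r.
Qed.

(** Terms beyond x^n cannot reach the coefficient of x^n, so identities for [xsum] reduce to finite
    sums. *)
Lemma coefM_xsum g H n :
  (g * xsum H) n = (g * \sum_(k < n.+1) H k * fpsX ^+ k) n.
Proof.
rewrite !coef_fpsM; apply: eq_bigr => i _; congr (_ * _).
rewrite xsum.unlock -(@fps_sumP _ _ _ _ n.+1) //; last by lia.
by move=> j l lj; rewrite mulrC coef_fpsXnM.
Qed.

Lemma coef_xsum H n : xsum H n = (\sum_(k < n.+1) H k * fpsX ^+ k) n.
Proof. by rewrite -[xsum H]mul1r coefM_xsum mul1r. Qed.

Lemma eq_xsum H1 H2 : H1 =1 H2 -> xsum H1 = xsum H2.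
Proof.
by move=> eqH; apply/fpsP => n; rewrite !coef_xsum; under eq_bigr do rewrite eqH.
Qed.

Lemma xsumM g H : g * xsum H = xsum (fun n => g * H n).
Proof.
apply/fpsP => n; rewrite coefM_xsum coef_xsum mulr_sumr.
by under [in RHS]eq_bigr do rewrite -mulrA.
Qed.

Lemma xsumD H1 H2 : xsum H1 + xsum H2 = xsum (fun n => H1 n + H2 n).
Proof.
apply/fpsP => n; rewrite coef_fpsD !coef_xsum -coef_fpsD -big_split /=.
by under [in RHS]eq_bigr do rewrite mulrDl.
Qed.

Lemma xsumB H1 H2 : xsum H1 - xsum H2 = xsum (fun n => H1 n - H2 n).
Proof.
rewrite -mulN1r xsumM xsumD; apply: eq_xsum => n.
by rewrite mulN1r.
Qed.

Lemma xsumS H : H 0%N = 0 -> xsum H = fpsX * xsum (fun n => H n.+1).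
Proof.
move=> H0; apply/fpsP => n; rewrite coef_xsum coefM_xsum big_ord_recl H0.
rewrite mul0r add0r mulr_sumr [in RHS]big_ord_recr coef_fpsD addrC.
rewrite mulrCA -exprS [X in X + _](_ : _ = 0) ?add0r; last first.
  by rewrite mulrC coef_fpsXnM.
case: n => [|n]; first by rewrite !big_ord0.
congr (fpscoef _ _); apply: eq_bigr => k _.
by rewrite lift0 exprS mulrCA.
Qed.

Lemma xsum1 f : xsum (fun n => if n == 1%N then f else 0) = fpsX * f.
Proof.
rewrite xsumS //; congr (_ * _); apply/fpsP => n.
rewrite coef_xsum big_ord_recl expr0 mulr1 big1 ?addr0 // => i _.
by rewrite lift0 mul0r.
Qed.

Lemma fpsC_natr n : fpsC n%:R = n%:R :> fps K.
Proof.
apply/fpsP => k; elim: n => [|n IHn].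
  by rewrite coef_fps0; case: k.
rewrite -[in RHS]natr1 coef_fpsD -IHn coef_fps1.
by case: k {IHn} => [|k] /=; rewrite ?natr1 ?addr0.
Qed.

Lemma gf_natr (c : nat -> nat -> nat -> nat) (a b : fps K) :
  gf (fun n i j => (c n i j)%:R) a b = xsum (fun n => slice c n a b).
Proof.
rewrite xsum.unlock /gf; congr fps_sum; apply: boolp.funext => n.
rewrite /slice mulr_suml; apply: eq_bigr => i _.
rewrite mulr_sumr mulr_suml; apply: eq_bigr => j _.
by rewrite fpsC_natr; ring.
Qed.

Lemma unit_fps1 f : f 0%N = 1 -> f \is a GRing.unit.
Proof.
move=> f1; suff : f \in @fps_unit K by [].
by rewrite inE f1 unitr1.
Qed.

End PowerSeries.

(** * The kernel method *)

Section FunctionalEquations.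
Variable K : fieldType.
Implicit Types a b f g : fps K.

Lemma to_yM f g : to_y (f * g) = to_y f * to_y g.
Proof.
apply/fpsP => n; rewrite coef_fpsM /= rmorph_sum.
by apply: eq_bigr => i _; rewrite rmorphM.
Qed.

Lemma to_y_exp f n : to_y (f ^+ n) = to_y f ^+ n.
Proof.
elim: n => [|n IHn]; last by rewrite !exprS to_yM IHn.
by apply/fpsP => -[|k].
Qed.

Lemma to_y_fpsX : to_y fpsX = fpsX :> fps {poly K}.
Proof. by apply/fpsP => n /=; rewrite rmorph_nat. Qed.

(** The arguments a and b are free of y, so extraction in y acts on the coefficients [c] alone. *)
Lemma coefy_gf (c : nat -> nat -> nat -> {poly K}) m a b :
  coefy m (gf c (to_y a) (to_y b)) = gf (fun n i j => (c n i j)`_m) a b.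
Proof.
apply/fpsP => n; rewrite /gf /= coef_sum; apply: eq_bigr => k _.
rewrite !coef_fps_sum coef_sum; apply: eq_bigr => i _.
rewrite !coef_fps_sum coef_sum; apply: eq_bigr => j _.
rewrite -!mulrA -to_y_fpsX -!to_y_exp -!to_yM.
by rewrite !coef_fpsCM coefMC.
Qed.

Lemma Rm_xsum m a b : Rm m.+1 a b = xsum (fun n => slice (nr m.+1) n a b).
Proof.
rewrite /Rm /R_gf /= coefy_gf -gf_natr; congr gf.
by do 3![apply: boolp.funext => ?]; rewrite coef_r_poly.
Qed.

(** The case m = 0 is included, by [ns0]; it supplies S_{m-1} for m = 1. *)
Lemma Sm_xsum m a b : Sm m a b = xsum (fun n => slice (ns m) n a b).
Proof.
rewrite /Sm /S_gf; case: eqP => [->|_]; last first.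
  rewrite coefy_gf -gf_natr; congr gf.
  by do 3![apply: boolp.funext => ?]; rewrite coef_s_poly.
apply/fpsP => n; rewrite coef_xsum big1 // => k _.
rewrite /slice big1 ?mul0r // => i _; rewrite big1 ?mulr0 // => j _.
by rewrite ns0 mul0r.
Qed.

Lemma xsum_combination (H1 H2 H3 H4 : nat -> fps K) a b :
  a * (xsum H1 - b * xsum H2) + a * b * (xsum H3 - b * xsum H4) =
  xsum (fun n => a * (H1 n - b * H2 n) + a * b * (H3 n - b * H4 n)).
Proof. by rewrite (xsumM b H2) (xsumM b H4) !xsumB (xsumM a) (xsumM (a * b)) xsumD. Qed.

Lemma Sm_functional m a b :
  (1 - b) * Sm m.+1 a b =
  fpsX * (a * (Rm m.+1 a 1 - b * Rm m.+1 a b) +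
          a * b * (Rm m.+1 a 0 - b * Rm m.+1 (a * b) 0)).
Proof.
rewrite !Rm_xsum Sm_xsum xsum_combination [LHS]xsumM [LHS]xsumS.
  by congr (_ * _); apply: eq_xsum => n; exact: slice_ns.
by rewrite slice0 mulr0.
Qed.

Lemma Rm_functional m a b :
  (1 - b) * (Rm m.+1 a b - Sm m.+1 a b) =
  (1 - b) * fpsX ^+ 2 * delta K m 0 + fpsX * (Sm m 1 a - b * Sm m 1 (a * b)).
Proof.
have -> : (1 - b) * fpsX ^+ 2 * delta K m 0
  = fpsX * (fpsX * ((1 - b) * delta K m 0)).
  by rewrite expr2 -!mulrA !(mulrCA (1 - b)).
rewrite -mulrDr -(xsum1 ((1 - b) * delta K m 0)) Rm_xsum !Sm_xsum (xsumM b).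
rewrite [X in _ * X = _]xsumB [X in _ = _ * (_ + X)]xsumB xsumD.
rewrite [LHS]xsumM [LHS]xsumS; last by rewrite !slice0 subrr mulr0.
congr (_ * _); apply: eq_xsum => -[|[|n]].
- by rewrite !slice1 !slice0 subrr !mulr0 subrr addr0.
- by rewrite [X in _ * X = _]slice_nr2 !slice1 mulr0 subrr addr0.
- by rewrite slice_nr //= add0r.
Qed.

End FunctionalEquations.

(** * Ring identities behind the kernel method *)

Section KernelAlgebra.
Variable A : comUnitRingType.
Implicit Types x a b d w q y z P R S T U : A.

(** The series become plain variables so that [ring] applies. In the functional identities of this
    section [R], [R0], [R1] stand for R at (a,b), (a,0), (a,1), and [Rb], [Rb1] for R at (ab,0),
    (ab,1); [T] and [Tb] stand for S_{m-1} at (1,a) and (1,ab), and [d] for the delta. Here b =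
    0. *)
Lemma solve_at0 x a d R R1 Rb S T Tb :
    (1 - 0) * S = x * (a * (R1 - 0 * R) + a * 0 * (R - 0 * Rb)) ->
    (1 - 0) * (R - S) = (1 - 0) * x ^+ 2 * d + x * (T - 0 * Tb) ->
  R = x ^+ 2 * d + x * T + x * a * R1.
Proof.
move=> e1 e2; have -> : R = (1 - 0) * (R - S) + (1 - 0) * S by ring.
by rewrite e1 e2; ring.
Qed.

Lemma eliminate_S x a b d R R1 R0 Rb S T Tb :
    (1 - b) * S = x * (a * (R1 - b * R) + a * b * (R0 - b * Rb)) ->
    (1 - b) * (R - S) = (1 - b) * x ^+ 2 * d + x * (T - b * Tb) ->
    R0 = x ^+ 2 * d + x * T + x * a * R1 ->
  R * (1 - b + x * a * b) = (1 + x * a * b) * R0 - x * a * b ^+ 2 * Rb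
    - b * x ^+ 2 * d - x * b * Tb.
Proof.
move=> e1 e2 e0; have -> : R * (1 - b + x * a * b) =
  (1 - b) * S + (1 - b) * (R - S) + x * a * b * R by ring.
by rewrite e1 e2 e0; ring.
Qed.

Lemma cancel_kernel x w b d R R0 R1 Rb Rb1 T Tb :
    b * (1 - x * w) = 1 ->
    R * (1 - b + x * w * b) = (1 + x * w * b) * R0 - x * w * b ^+ 2 * Rb
      - b * x ^+ 2 * d - x * b * Tb ->
    R0 = x ^+ 2 * d + x * T + x * w * R1 ->
    Rb = x ^+ 2 * d + x * Tb + x * (w * b) * Rb1 ->
  x * (w * R1) =
  x * (b * (x ^+ 2 * w * d - (1 - x * w) * T + Tb)
       + x * w * b * ((w * b) * Rb1)).
Proof.
move=> bE eqR R0E RbE.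
have kb : 1 + x * w * b = b by rewrite -[X in X + _]bE; ring.
have k0 : 1 - b + x * w * b = 0 by rewrite addrAC kb subrr.
rewrite k0 mulr0 kb in eqR; apply/eqP; rewrite -subr_eq0; apply/eqP.
(* The first product vanishes by the equation at the kernel root, the second because b(1-xw) = 1;
   with these multipliers no division is left. *)
transitivity ((1 - x * w) *
    (b * R0 - x * w * b ^+ 2 * Rb - b * x ^+ 2 * d - x * b * Tb)
  - (b * (1 - x * w) - 1) *
    (R0 - x * w * b * Rb - x ^+ 2 * d - x * Tb - x * T + x * Tb)).
  by rewrite R0E RbE; ring.
by rewrite -eqR bE subrr mulr0 mul0r subrr.
Qed.

Lemma iterate_inv x w q q' :
    q \is a GRing.unit -> q' \is a GRing.unit -> q' = q - x * w ->
  (1 - x * (w / q))^-1 = q / q'.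
Proof.
move=> Uq Uq' q'E.
have -> : 1 - x * (w / q) = q' / q by rewrite q'E mulrBl divrr // mulrA.
by rewrite invrM ?unitrV // invrK.
Qed.

Lemma iterate_arg w q q' : q \is a GRing.unit -> w / q * (q / q') = w / q'.
Proof. by move=> Uq; rewrite -mulrA mulKr. Qed.

Lemma iterate_term x w q q' P y R z :
    q \is a GRing.unit -> q' \is a GRing.unit -> P \is a GRing.unit ->
  y / P * (q / q' * R + x * (w / q) * (q / q') * z) =
  y * q / (P * q') * R + (y * (x * w)) / (P * q') * z.
Proof.
move=> Uq Uq' UP; rewrite -[x * (w / q) * _]mulrA iterate_arg // invrM //.
by move: P^-1 q'^-1 => Pi qi; ring.
Qed.

Lemma iterate0 x w : w / (1 - 0%:R * x * w) = w.
Proof. by rewrite !mul0r subr0 divr1. Qed.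

Lemma iterate0_term y z : z = 0 + y ^+ 0 / 1 * z.
Proof. by rewrite expr0 divr1 mul1r add0r. Qed.

Lemma pull_power x w P z n :
  (x * w) ^+ n / P * z = x ^+ n * (w ^+ n / P * z).
Proof. by rewrite exprMn !mulrA. Qed.

Lemma solve_R x u v d R R0 Rb R1 Rb1 U V T Tb :
    1 - v + x * u * v \is a GRing.unit ->
    R * (1 - v + x * u * v) = (1 + x * u * v) * R0 - x * u * v ^+ 2 * Rb
      - v * x ^+ 2 * d - x * v * Tb ->
    R0 = x ^+ 2 * d + x * T + x * u * R1 ->
    Rb = x ^+ 2 * d + x * Tb + x * (u * v) * Rb1 ->
    U = u * R1 -> V = u * v * Rb1 ->
  R = (x ^+ 2 * (1 - v) * (1 + x * u * v)) / (1 - v + x * u * v) * d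
    + (x * (1 + x * u * v)) / (1 - v + x * u * v) * (T - v * Tb)
    + (x * (1 + x * u * v)) / (1 - v + x * u * v) * U
    - (x ^+ 2 * u * v ^+ 2) / (1 - v + x * u * v) * V.
Proof.
move=> UD RD R0E RbE -> ->; rewrite -[LHS](mulrK UD) RD R0E RbE.
by move: (_ ^-1) => Di; ring.
Qed.

Lemma solve_S x v d R S T :
    1 - v \is a GRing.unit ->
    (1 - v) * (R - S) = (1 - v) * x ^+ 2 * d + x * T ->
  S = R - x ^+ 2 * d - x / (1 - v) * T.
Proof.
move=> Uv e; have -> : S = R - (1 - v)^-1 * ((1 - v) * (R - S)).
  by rewrite mulKr // subKr.
by rewrite e mulrDr -mulrA mulKr //; move: (_ ^-1) => vi; ring.
Qed.

End KernelAlgebra.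

(** * Solving for R(w,1) by iteration *)

Section Kernel.
Variables (K : fieldType) (m : nat).
Implicit Types a b w : fps K.

Local Notation x := (fpsX : fps K).
Local Notation d := (delta K m 0).

Lemma Rm_at0 a :
  Rm m.+1 a 0 = x ^+ 2 * d + x * Sm m 1 a + x * a * Rm m.+1 a 1.
Proof. exact: solve_at0 (Sm_functional m a 0) (Rm_functional m a 0). Qed.

Lemma kernel_equation a b :
  Rm m.+1 a b * (1 - b + x * a * b) =
  (1 + x * a * b) * Rm m.+1 a 0 - x * a * b ^+ 2 * Rm m.+1 (a * b) 0
  - b * x ^+ 2 * d - x * b * Sm m 1 (a * b).
Proof.
exact: eliminate_S (Sm_functional m a b) (Rm_functional m a b) (Rm_at0 a).
Qed.

Lemma unit_1BxM a w : 1 - a * x * w \is a GRing.unit.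
Proof.
apply: unit_fps1; rewrite coef_fpsD coef_fpsN coef_fps1 [a * x]mulrC -mulrA.
by rewrite coef_fpsXM0 subr0.
Qed.

Lemma Rm'E w : Rm' m.+1 w =
  x ^+ 2 * w * d - (1 - x * w) * Sm m 1 w + Sm m 1 (w * (1 - x * w)^-1).
Proof. by rewrite /Rm' subSS subn0. Qed.

(* The kernel 1 - b + xwb vanishes at b = 1/(1 - xw). *)
Lemma Rm_at1_rec w : let b := (1 - x * w)^-1 in
  w * Rm m.+1 w 1 = b * Rm' m.+1 w + x * w * b * ((w * b) * Rm m.+1 (w * b) 1).
Proof.
move=> b; have Ub : 1 - x * w \is a GRing.unit.
  by have := unit_1BxM 1 w; rewrite mul1r.
(* The kernel equation only yields the identity multiplied by x, a non-zero-divisor. *)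
rewrite Rm'E; apply: fpsXM_inj.
exact: cancel_kernel (mulVr Ub) (kernel_equation w b) (Rm_at0 w) (Rm_at0 (w * b)).
Qed.

Definition Rm_at1_term w (j : nat) : fps K :=
  (x * w) ^+ j * (1 - j%:R * x * w)
  / (\prod_(1 <= i < j.+2) (1 - i%:R * x * w))
  * Rm' m.+1 (w / (1 - j%:R * x * w)).

(** With [q] = 1 - jxw and [q'] = 1 - (j+1)xw, the argument w/q has kernel root b = q/q', and (w/q)b
    = w/q' is the next argument. Each round multiplies the remainder by xw/q', whence the product in
    the denominators; the factor b of R'_m puts [q] into the numerator. *)
Lemma Rm_at1_iter w J :
  w * Rm m.+1 w 1 = \sum_(j < J) Rm_at1_term w j
    + (x * w) ^+ J / (\prod_(1 <= i < J.+1) (1 - i%:R * x * w))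
      * (w / (1 - J%:R * x * w) * Rm m.+1 (w / (1 - J%:R * x * w)) 1).
Proof.
elim: J => [|J IHJ].
  by rewrite big_ord0 big_geq // iterate0; exact: iterate0_term.
rewrite {}IHJ big_ord_recr -addrA; congr (_ + _).
set q := 1 - J%:R * x * w; set q' := 1 - J.+1%:R * x * w.
have Uq : q \is a GRing.unit := unit_1BxM _ _.
have Uq' : q' \is a GRing.unit := unit_1BxM _ _.
have q'E : q' = q - x * w.
  by rewrite /q' /q -natr1 [(J%:R + 1) * x]mulrDl mulrDl mul1r opprD addrA.
have UP : \prod_(1 <= i < J.+1) (1 - i%:R * x * w) \is a GRing.unit.
  by apply: rpred_prod => i _; exact: unit_1BxM.
rewrite (Rm_at1_rec (w / q)) (iterate_inv Uq Uq' q'E) (iterate_arg _ _ Uq).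
rewrite /Rm_at1_term (big_nat_recr J.+1) //= -/q -/q' exprSr.
exact: iterate_term.
Qed.

Lemma Rm_at1_sum w (F : nat -> fps K) : F =1 Rm_at1_term w ->
  fps_sum F = w * Rm m.+1 w 1.
Proof.
move=> FE; apply/fpsP => n.
(* After [n.+1] rounds the remainder is divisible by x^(n+1). *)
rewrite (Rm_at1_iter w n.+1) coef_fpsD pull_power coef_fpsXnM // addr0.
by rewrite coef_fps_sum; apply: eq_bigr => j _; rewrite FE.
Qed.

End Kernel.

Lemma vvar0_neq1 : vvar 0%N != 1.
Proof.
rewrite -[1 in X in _ != X]tofrac1 tofrac_eq; apply/eqP.
move=> /(congr1 (fun p : {poly {poly rat}} => p`_0)).
by rewrite coefX coef1 => /eqP; rewrite eq_sym oner_eq0.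
Qed.

(** The constant term in x is 1 - v, nonzero in the field Q(u,v). *)
Lemma unit_1BvDxM (f : fps Quv) : 1 - vvar + fpsX * f \is a GRing.unit.
Proof.
suff : 1 - vvar + fpsX * f \in @fps_unit Quv by [].
rewrite inE coef_fpsD coef_fpsXM0 addr0 coef_fpsD coef_fpsN coef_fps1 unitfE.
by rewrite subr_eq0 eq_sym vvar0_neq1.
Qed.

Theorem theorem3p6 (m : nat) (hm : (1 <= m)%N) :
  let x : fps Quv := fpsX in
  let u : fps Quv := uvar in
  let v : fps Quv := vvar in
  Rm m u v =
      (x ^+ 2 * (1 - v) * (1 + x * u * v)) / (1 - v + x * u * v) * delta Quv m 1
    + (x * (1 + x * u * v)) / (1 - v + x * u * v)
        * (Sm (m - 1) 1 u - v * Sm (m - 1) 1 (u * v))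
    + (x * (1 + x * u * v)) / (1 - v + x * u * v)
        * (\fsum_j (((x * u) ^+ j * (1 - j%:R * x * u))
                      / (\prod_(1 <= i < j.+2) (1 - i%:R * x * u))
                      * Rm' m (u / (1 - j%:R * x * u))))
    - (x ^+ 2 * u * v ^+ 2) / (1 - v + x * u * v)
        * (\fsum_j (((x * u * v) ^+ j * (1 - j%:R * x * u * v))
                      / (\prod_(1 <= i < j.+2) (1 - i%:R * x * u * v))
                      * Rm' m ((u * v) / (1 - j%:R * x * u * v))))
  /\
  Sm m u v =
      Rm m u v - x ^+ 2 * delta Quv m 1
    - x / (1 - v) * (Sm (m - 1) 1 u - v * Sm (m - 1) 1 (u * v)).
Proof.
case: m hm => // m _ x u v; rewrite subSS subn0; split.
  apply: solve_R (kernel_equation m u v) (Rm_at0 m u) (Rm_at0 m (u * v)) _ _.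
  - by rewrite -mulrA; exact: unit_1BvDxM.
  - exact: Rm_at1_sum.
  (* For w = uv the summands agree up to reassociating x(uv) as (xu)v. *)
  - apply: Rm_at1_sum => j; rewrite /Rm_at1_term !mulrA.
    by under [in RHS]eq_bigr do rewrite mulrA.
apply: solve_S (Rm_functional m u v).
by have := unit_1BvDxM 0; rewrite mulr0 addr0.
Qed.
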